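(* Let $\epsilon>0$. If $H=(U_1,U_2;F)$ is a bipartite graph with $n$ vertices such that every vertex in $U_2$ has degree $2$, and $G$ is a graph with $2N$ vertices and $2\epsilon N^2$ edges where $N \geq 128\epsilon^{-3}n$, then $H$ is a subgraph of $G$.
   Context: $H=(U_1,U_2;F)$ denotes a bipartite graph with parts $U_1,U_2$ and edge set $F$. Subgraph containment is not necessarily induced. *)

(* Defs.v *)
From HB Require Import structures.
From mathcomp Require Import all_boot all_order all_algebra.
From mathcomp Require Import reals.

Set Implicit Arguments.
Unset Strict Implicit.
Unset Printing Implicit Defensive.

Record sgraph (V : finType) := SGraph {
  adj :> rel V;
  adj_sym : symmetric adj;
  adj_irr : irreflexive adj
}.

Section Graphs.
Variable V : finType.
Implicit Types (G : sgraph V) (x : V) (U : {set V}).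

(* Edges are unordered pairs, so each is counted once. *)
Definition edges G : {set {set V}} := [set [set x; y] | x in V, y in V & adj G x y].

Definition degree G x : nat := #|[set y | adj G x y]|.

Definition bipartition G U1 U2 : Prop :=
  [/\ U1 :|: U2 = [set: V],
      [disjoint U1 & U2]
    & forall x y, adj G x y ->
        (x \in U1 /\ y \in U2) \/ (x \in U2 /\ y \in U1)].

End Graphs.

(* H is isomorphic to a (not necessarily induced) subgraph of G. *)
Definition is_subgraph (V W : finType) (H : sgraph V) (G : sgraph W) : Prop :=
  exists f : V -> W, injective f /\ forall x y, adj H x y -> adj G (f x) (f y).

(* Main.v *)
(** Call a pair of vertices of [G] bad if it has fewer than [n] common
    neighbours.  Start from the set [C 0] of vertices of degree at least [eps N],
    which has at least [eps N] elements.  Intersecting a set with the neighbourhood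
    of a random vertex keeps a proportion [eps / 2] of it on average, whereas each
    bad pair survives with probability less than [n / (2 N)]; choosing well and
    discarding the vertices in many bad pairs yields nested sets [C i] of size at
    least [(eps / 8) ^+ i * eps * N] in which each vertex is bad to a proportion at
    most [(eps / 12) ^+ i] of the others.  Put [D = 8 / eps].  At most
    [2 n / D ^+ i] vertices of [U1] have degree at least [D ^+ i], so [U1] can be
    embedded greedily by decreasing degree, deep in the chain for vertices of high
    degree, making every pair with a common neighbour in [U2] good.  A good pair has
    enough common neighbours to embed [U2] greedily afterwards. *)
Require Import Defs.
From mathcomp Require Import all_boot all_order all_algebra.
From mathcomp Require Import reals lra ring zify.
Import Order.TTheory GRing.Theory Num.Theory.
Local Open Scope ring_scope.

Set Implicit Arguments.
Unset Strict Implicit.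
Unset Printing Implicit Defensive.

(** * Bad pairs and double counting over neighbourhoods *)

Definition nbhd (V : finType) (G : sgraph V) (x : V) : {set V} :=
  [set y | adj G x y].

Definition bad_pair (m : nat) (V : finType) (G : sgraph V) (x y : V) : bool :=
  (#|nbhd G x :&: nbhd G y| < m)%N.

Definition bad_degree (m : nat) (V : finType) (G : sgraph V) (S : {set V})
    (x : V) : nat :=
  #|[set y in S | bad_pair m G x y]|.

Lemma bad_pairC (m : nat) (V : finType) (G : sgraph V) (x y : V) :
  bad_pair m G x y = bad_pair m G y x.
Proof. by rewrite /bad_pair setIC. Qed.

Lemma card_set_sum (V : finType) (S : {set V}) (P : pred V) :
  #|[set x in S | P x]| = (\sum_(x in S) P x)%N.
Proof.
rewrite -sum1_card (eq_bigl (fun x => (x \in S) && P x)) => [|x].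
  by rewrite big_mkcondr /=; apply: eq_bigr => x _; case: (P x).
by rewrite inE.
Qed.

Lemma card_bigcup_le_sum (I V : finType) (P : pred I) (F : I -> {set V}) :
  (#|\bigcup_(i | P i) F i| <= \sum_(i | P i) #|F i|)%N.
Proof.
apply: (big_ind2 (fun (A : {set V}) k => (#|A| <= k)%N)); rewrite ?cards0 //.
move=> A k B l hA hB; rewrite cardsU.
by apply: leq_trans (leq_subr _ _) _; apply: leq_add.
Qed.

Lemma sum_card_setI_nbhd (V : finType) (G : sgraph V) (S : {set V}) :
  (\sum_w #|S :&: nbhd G w| = \sum_(x in S) degree G x)%N.
Proof.
transitivity (\sum_w \sum_(x in S) adj G w x)%N.
  apply: eq_bigr => w _; rewrite -card_set_sum; apply: eq_card => x.
  by rewrite !inE.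
rewrite exchange_big; apply: eq_bigr => x _.
transitivity (\sum_(w in [set: V]) adj G x w)%N.
  by apply: eq_big => [w|w _]; rewrite ?inE // adj_sym.
by rewrite -card_set_sum; apply: eq_card => w; rewrite !inE.
Qed.

Lemma bad_degree_sum (m : nat) (V : finType) (G : sgraph V) (S : {set V}) (x : V) :
  bad_degree m G S x = (\sum_(y in S) bad_pair m G x y)%N.
Proof. exact: card_set_sum. Qed.

Lemma sum_setI (V : finType) (A B : {set V}) (F : V -> nat) :
  (\sum_(x in A :&: B) F x = \sum_(x in A) (x \in B) * F x)%N.
Proof.
rewrite (eq_bigl (fun x => (x \in A) && (x \in B))) => [|x]; last by rewrite inE.
by rewrite big_mkcondr; apply: eq_bigr => x _; case: (x \in B); rewrite ?mul1n.
Qed.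

(* A bad pair survives in [S :&: nbhd G w] only for the fewer than [m] vertices
   [w] in its common neighbourhood. *)
Lemma sum_bad_degree_nbhd (m : nat) (V : finType) (G : sgraph V) (S : {set V}) :
  (\sum_w \sum_(x in S :&: nbhd G w) bad_degree m G (S :&: nbhd G w) x
     <= m * \sum_(x in S) bad_degree m G S x)%N.
Proof.
have -> : (\sum_w \sum_(x in S :&: nbhd G w) bad_degree m G (S :&: nbhd G w) x
  = \sum_(x in S) \sum_(y in S)
      \sum_w (x \in nbhd G w) * ((y \in nbhd G w) * bad_pair m G x y))%N.
  transitivity (\sum_w \sum_(x in S) \sum_(y in S)
     (x \in nbhd G w) * ((y \in nbhd G w) * bad_pair m G x y))%N.
    apply: eq_bigr => w _; rewrite sum_setI; apply: eq_bigr => x _.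
    by rewrite bad_degree_sum sum_setI big_distrr.
  by rewrite exchange_big; apply: eq_bigr => x _; rewrite exchange_big.
rewrite big_distrr /=; apply: leq_sum => x _.
rewrite bad_degree_sum big_distrr /=; apply: leq_sum => y _.
case: (boolP (bad_pair m G x y)) => [bxy|_]; last first.
  by rewrite big1 // => w _; rewrite !muln0.
rewrite muln1; apply: leq_trans (ltnW bxy).
rewrite -sum1_card [leqRHS]big_mkcond /=; apply: leq_sum => w _.
by rewrite !inE !(@adj_sym _ G w) muln1; case: adj; case: adj.
Qed.

(** * The nested chain, by dependent random choice *)

(** Averaging over [w] with [T := S :&: nbhd G w]: the mean size is at least [eps / 2 * #|S|], while
    bad pairs rarely survive. If every [w] failed one of the two bounds, the sum of the squared
    sizes would be too small. *)
Lemma exists_dense_nbhd (R : realType) (eps b : R) (m N : nat)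
    (W : finType) (G : sgraph W) (S : {set W}) :
  0 < eps -> 0 < b -> (0 < N)%N -> #|W| = (2 * N)%N ->
  128 * m%:R <= eps ^+ 3 * N%:R ->
  (forall x, x \in S -> eps * N%:R <= (degree G x)%:R) ->
  (forall x, x \in S -> (bad_degree m G S x)%:R <= b * #|S|%:R) ->
  exists2 T : {set W}, T \subset S &
    eps / 4 * #|S|%:R <= #|T|%:R /\
    (\sum_(x in T) bad_degree m G T x)%:R <= eps / 48 * b * #|T|%:R ^+ 2.
Proof.
move=> e0 b0 N0 cW hm hdeg hbad.
have N0R : 0 < N%:R :> R by rewrite ltr0n.
pose a w : R := #|S :&: nbhd G w|%:R.
pose B w : R := (\sum_(x in S :&: nbhd G w) bad_degree m G (S :&: nbhd G w) x)%:R.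
pose s : R := #|S|%:R.
have s0 : 0 <= s by rewrite ler0n.
have [w /andP[h1 h2]|none] :=
  pickP (fun w => (eps / 4 * s <= a w) && (B w <= eps / 48 * b * a w ^+ 2)).
  by exists (S :&: nbhd G w); rewrite ?subsetIl.
have suma : s * (eps * N%:R) <= \sum_w a w.
  rewrite -natr_sum sum_card_setI_nbhd natr_sum /s -sum1_card natr_sum mulr_suml.
  by apply: ler_sum => x xS; rewrite mul1r hdeg.
have sumB : \sum_w B w <= m%:R * (b * s ^+ 2).
  rewrite -natr_sum.
  apply: (@le_trans _ _ (m * \sum_(x in S) bad_degree m G S x)%:R).
    by rewrite ler_nat sum_bad_degree_nbhd.
  rewrite natrM ler_wpM2l ?ler0n // natr_sum.
  rewrite (_ : b * s ^+ 2 = \sum_(x in S) (b * s)) ?ler_sum //.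
  by rewrite sumr_const -mulr_natr expr2 mulrA.
pose k := 48 / (eps * b).
have k0 : 0 < k by rewrite divr_gt0 ?mulr_gt0.
(* The left side is the tangent to the square at [eps * s / 2], a lower bound for the mean of [a w].
   It lies below [a w ^+ 2], so a bound on the sum of the [a w] suffices. *)
have pw w : eps * s * a w - (eps * s) ^+ 2 / 4 < (eps * s) ^+ 2 / 16 + k * B w.
  apply: (@le_lt_trans _ _ (a w ^+ 2)).
    have := sqr_ge0 (a w - eps * s / 2); lra.
  have aw0 : 0 <= a w by rewrite ler0n.
  have Bw0 : 0 <= B w by rewrite ler0n.
  have := none w; move/negbT; rewrite negb_and -!ltNge => /orP[h|h].
    have : a w ^+ 2 < (eps * s / 4) ^+ 2.
      by rewrite ltr_pXn2r ?nnegrE //; [lra | rewrite divr_ge0 ?mulr_ge0 // ltW].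
    have : 0 <= k * B w by rewrite mulr_ge0 // ltW.
    lra.
  have : a w ^+ 2 < k * B w.
    have -> : a w ^+ 2 = k * (eps / 48 * b * a w ^+ 2).
      by rewrite /k; field; rewrite !gt_eqF.
    by rewrite ltr_pM2l.
  by have := sqr_ge0 (eps * s); lra.
have sumW (c : R) : \sum_(w : W) c = c * (2 * N%:R).
  by rewrite sumr_const cardT -cardE cW -natrM mulr_natr.
have [w0 _] : exists w0 : W, w0 \in W.
  by apply/card_gt0P; rewrite cW muln_gt0.
have : \sum_w (eps * s * a w - (eps * s) ^+ 2 / 4)
     < \sum_w ((eps * s) ^+ 2 / 16 + k * B w).
  by apply: ltr_sum => //; apply/hasP; exists w0; rewrite ?mem_index_enum.
rewrite big_split /= [X in _ < X]big_split /= -!mulr_sumr !sumW.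
have : eps * s * (s * (eps * N%:R)) <= eps * s * \sum_w a w.
  by rewrite ler_wpM2l // mulr_ge0 // ltW.
(* Here [3 / 8] is [48 / 128]. The summed inequality then has left side at least, and right side at
   most, [(eps * s) ^+ 2 * N / 2], so its strictness gives the contradiction. *)
have : k * (\sum_w B w) <= 3 / 8 * (eps * s) ^+ 2 * N%:R.
  apply: (@le_trans _ _ (k * (m%:R * (b * s ^+ 2)))).
    by rewrite ler_wpM2l // ltW.
  have -> : k * (m%:R * (b * s ^+ 2)) = (3 / 8 * s ^+ 2 / eps) * (128 * m%:R).
    by rewrite /k; field; rewrite !gt_eqF.
  apply: (@le_trans _ _ ((3 / 8 * s ^+ 2 / eps) * (eps ^+ 3 * N%:R))).
    by rewrite ler_wpM2l // divr_ge0 ?(ltW e0) // mulr_ge0 ?sqr_ge0 // divr_ge0.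
  by rewrite le_eqVlt; apply/orP; left; apply/eqP; field; rewrite gt_eqF.
set X := \sum_w B w; set Y := \sum_w a w.
move=> h1 h2 h3; lra.
Qed.

(** Markov's inequality: at most half of [S] has bad degree above [2 * q * #|S|]. Passing from
    [#|S|] to [#|T|] costs the other factor [2]. *)
Lemma exists_small_bad_degree (R : realType) (q : R) (m : nat) (W : finType)
    (G : sgraph W) (S : {set W}) :
  0 < q -> (\sum_(x in S) bad_degree m G S x)%:R <= q * #|S|%:R ^+ 2 ->
  exists2 T : {set W}, T \subset S & #|S|%:R <= 2 * #|T|%:R :> R /\
    forall x, x \in T -> (bad_degree m G T x)%:R <= 4 * q * #|T|%:R.
Proof.
move=> q0 hS.
pose T := [set x in S | (bad_degree m G S x)%:R <= 2 * q * #|S|%:R].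
have sTS : T \subset S by apply/subsetP => x; rewrite inE => /andP[].
have cT : #|S|%:R = #|T|%:R + #|S :\: T|%:R :> R.
  by rewrite -natrD; congr _%:R; rewrite -(cardsID T S) (setIidPr sTS).
have hT : #|S|%:R <= 2 * #|T|%:R :> R.
  have [s0|s0] := posnP #|S|; first by rewrite s0 mulr_ge0.
  have s0R : 0 < #|S|%:R :> R by rewrite ltr0n.
  suff : 2 * #|S :\: T|%:R <= #|S|%:R :> R by lra.
  rewrite -(@ler_pM2r _ (q * #|S|%:R)) ?mulr_gt0 //.
  apply: (le_trans _ (le_trans hS _)); last by rewrite expr2; lra.
  rewrite (big_setID T) (setIidPr sTS) /= natrD.
  rewrite -[X in X <= _]add0r lerD ?ler0n // natr_sum.
  have -> : 2 * #|S :\: T|%:R * (q * #|S|%:R)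
      = \sum_(x in S :\: T) (2 * q * #|S|%:R) :> R.
    by rewrite sumr_const -mulr_natr; ring.
  apply: ler_sum => x; rewrite !inE => /andP[+ xS].
  by rewrite xS /= -ltNge => /ltW.
exists T => //; split=> // x; rewrite inE => /andP[xS hx].
apply: (@le_trans _ _ (bad_degree m G S x)%:R).
  rewrite ler_nat subset_leq_card //; apply/subsetP => y.
  by rewrite !inE => /andP[/andP[-> _] ->].
apply: (le_trans hx).
by have : q * #|S|%:R <= q * (2 * #|T|%:R); [rewrite ler_pM2l | lra].
Qed.

(** The constants combine: [eps / 8] is half of [eps / 4], and [eps / 12] is four times
    [eps / 48]. *)
Lemma bad_degree_descent (R : realType) (eps b : R) (m N : nat)
    (W : finType) (G : sgraph W) (S : {set W}) :
  0 < eps -> 0 < b -> (0 < N)%N -> #|W| = (2 * N)%N ->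
  128 * m%:R <= eps ^+ 3 * N%:R ->
  (forall x, x \in S -> eps * N%:R <= (degree G x)%:R) ->
  (forall x, x \in S -> (bad_degree m G S x)%:R <= b * #|S|%:R) ->
  exists T : {set W}, [/\ T \subset S, eps / 8 * #|S|%:R <= #|T|%:R &
    forall x, x \in T -> (bad_degree m G T x)%:R <= eps / 12 * b * #|T|%:R].
Proof.
move=> e0 b0 N0 cW hm hdeg hbad.
have [T0 sT0 [cT0 bT0]] := exists_dense_nbhd e0 b0 N0 cW hm hdeg hbad.
have q0 : 0 < eps / 48 * b by rewrite mulr_gt0 ?divr_gt0.
have [T sT [cT bT]] := exists_small_bad_degree q0 bT0.
exists T; split; first exact: subset_trans sT sT0.
  by lra.
by move=> x /bT h; apply: (le_trans h); lra.
Qed.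

Lemma bad_degree_chain (R : realType) (eps : R) (m N : nat)
    (W : finType) (G : sgraph W) (S : {set W}) :
  0 < eps -> (0 < N)%N -> #|W| = (2 * N)%N ->
  128 * m%:R <= eps ^+ 3 * N%:R ->
  (forall x, x \in S -> eps * N%:R <= (degree G x)%:R) ->
  exists C : nat -> {set W}, [/\ forall i, C i.+1 \subset C i,
    forall i, (eps / 8) ^+ i * #|S|%:R <= #|C i|%:R &
    forall i x, x \in C i ->
      (bad_degree m G (C i) x)%:R <= (eps / 12) ^+ i * #|C i|%:R].
Proof.
move=> e0 N0 cW hm hdeg.
pose small (b : R) (T : {set W}) :=
  [forall x in T, (bad_degree m G T x)%:R <= b * #|T|%:R].
(* [odflt T] makes [next] total; along the chain [pick] succeeds, by [bad_degree_descent] and the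
   invariant. The exponent is one below the index of the set [U] in the [pick] test, but [next]
   receives the index of the new set. *)
pose next i (T : {set W}) := odflt T [pick U : {set W} |
  [&& U \subset T, eps / 8 * #|T|%:R <= #|U|%:R & small ((eps / 12) ^+ i) U]].
pose C := fix C i := if i is j.+1 then next i (C j) else S.
have step i : C i \subset S -> small ((eps / 12) ^+ i) (C i) ->
    [/\ C i.+1 \subset C i, eps / 8 * #|C i|%:R <= #|C i.+1|%:R
      & small ((eps / 12) ^+ i.+1) (C i.+1)].
  move=> sCS bC; rewrite /= /next; case: pickP => [U /and3P[]//|none].
  have b0 : 0 < (eps / 12) ^+ i by rewrite exprn_gt0 ?divr_gt0.
  have [T [sT cT bT]] := bad_degree_descent e0 b0 N0 cW hm
    (fun x xC => hdeg x (subsetP sCS x xC)) (fun x xC => forall_inP bC x xC).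
  by have := none T; rewrite sT cT /=; case/forall_inP => x /bT; rewrite exprS.
have inv i : C i \subset S /\ small ((eps / 12) ^+ i) (C i).
  elim: i => [|i [sCS bC]].
    split=> //; apply/forall_inP => x _; rewrite expr0 mul1r ler_nat.
    by rewrite subset_leq_card //; apply/subsetP=> y; rewrite inE => /andP[].
  by have [sC _ bC'] := step i sCS bC; split=> //; apply: subset_trans sC sCS.
exists C; split=> [i|i|i x xC]; first by have [/step h /h[]] := inv i.
  elim: i => [|i IH]; first by rewrite expr0 mul1r.
  have [/step h /h[_ {}h _]] := inv i; apply: le_trans h.
  by rewrite exprS -mulrA ler_wpM2l // divr_ge0 // ltW.
by have [_ /forall_inP] := inv i; apply.
Qed.

(** * Degrees in [H] and the greedy embedding of [U1] *)

(** Edges at [U1] end in [U2], so they can be counted from there, at most [d] at each vertex. *)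
Lemma sum_degree_part (V : finType) (H : sgraph V) (U1 U2 : {set V}) (d : nat) :
  bipartition H U1 U2 -> (forall u, u \in U2 -> degree H u = d) ->
  (\sum_(u in U1) degree H u <= d * #|U2|)%N.
Proof.
move=> [cov disj bip] deg2.
rewrite -sum_card_setI_nbhd (bigID [in U2]) /= [X in (_ + X)%N]big1 ?addn0.
  rewrite mulnC -sum_nat_const; apply: leq_sum => z /deg2 <-.
  by rewrite subset_leq_card // subsetIr.
move=> z zU2; apply: eq_card0 => x; rewrite !inE.
apply/andP => -[xU1 /bip[[zU1 xU2]|[zU2' _]]]; last by rewrite zU2' in zU2.
by have := disjointFr disj xU1; rewrite xU2.
Qed.

(** For [d = 1] this bounds the number of vertices sharing a neighbour with [v], hence the
    constraints met when [v] is embedded. *)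
Lemma card_nbhd_nbhd (V : finType) (H : sgraph V) (d : nat) (v : V) :
  (forall z, adj H v z -> degree H z = d.+1) ->
  (#|\bigcup_(z in nbhd H v) (nbhd H z :\ v)| <= degree H v * d)%N.
Proof.
move=> hd; apply: leq_trans (_ : (\sum_(z in nbhd H v) #|nbhd H z :\ v| <= _)%N).
  exact: card_bigcup_le_sum.
rewrite -sum_nat_const; apply: leq_sum => z; rewrite inE => vz.
have := cardsD1 v (nbhd H z); rewrite inE adj_sym vz.
by have := hd z vz; rewrite /degree -/(nbhd H z) => ->; rewrite add1n; case=> <-.
Qed.

Lemma exists_log_scale (R : realType) (D : R) (d : nat) : 2 <= D ->
  exists k, d%:R < D ^+ k.
Proof.
move=> D2; exists d; apply: (@lt_le_trans _ _ (2 ^ d)%:R).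
  by rewrite ltr_nat ltn_expl.
by rewrite natrX lerXn2r ?nnegrE ?(le_trans _ D2).
Qed.

Lemma decreasing_subset (W : finType) (C : nat -> {set W}) (i j : nat) :
  (forall i, C i.+1 \subset C i) -> (i <= j)%N -> C j \subset C i.
Proof.
by move=> hC /subnK <-; elim: (j - i)%N => // k; apply: subset_trans (hC _).
Qed.

(* Vertices are embedded in decreasing order of degree, a vertex of degree about
   [D ^+ j] going into [C j]: it has at most [D ^+ j] constraints from earlier
   vertices, and there are at most [2 n / D ^+ j.-1] earlier vertices. *)
Lemma embed_high_degree_part (R : realType) (D : R) (m n : nat)
    (V : finType) (H : sgraph V) (U1 U2 : {set V})
    (W : finType) (G : sgraph W) (C : nat -> {set W}) :
  4 <= D -> (0 < n)%N -> #|V| = n ->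
  bipartition H U1 U2 -> (forall u, u \in U2 -> degree H u = 2%N) ->
  (forall i, C i.+1 \subset C i) ->
  (forall i, 2 * D ^+ 2 * n%:R <= D ^+ i * #|C i|%:R) ->
  (forall i x, x \in C i ->
     D ^+ i * (bad_degree m G (C i) x)%:R <= (2 / 3) ^+ i * #|C i|%:R) ->
  exists f : V -> W, {in U1 &, injective f} /\
    forall u v z, u \in U1 -> v \in U1 -> u != v -> adj H z u -> adj H z v ->
      ~~ bad_pair m G (f u) (f v).
Proof.
move=> D4 n0 cV bip deg2 hC cardC badC.
have D0 : 0 < D by lra.
have D2 : 2 <= D by lra.
(* Rounding degree [0] up to [1] puts every vertex at level at least [1], where the proportion
   [(2 / 3) ^+ j v] is at most [2 / 3]. *)
pose d v := maxn (degree H v) 1.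
pose j v := ex_minn (exists_log_scale (d v) D2).
have jP v : (d v)%:R < D ^+ j v by rewrite /j; case: ex_minnP.
have j_min v k : (d v)%:R < D ^+ k -> (j v <= k)%N.
  by rewrite /j; case: ex_minnP => i _; apply.
have j_gt0 v : (0 < j v)%N.
  rewrite lt0n; apply/eqP => j0; have := jP v.
  by rewrite j0 expr0 ltrn1 /d; case: (degree H v).
have j_pred v : D ^+ (j v).-1 <= (d v)%:R.
  by rewrite leNgt; apply/negP => /j_min; rewrite leqNgt prednK ?j_gt0 ?leqnn.
have j_mono u v : (d u <= d v)%N -> (j u <= j v)%N.
  by move=> duv; apply: j_min; apply: le_lt_trans (jP v); rewrite ler_nat.
have C_gt0 i : 0 < #|C i|%:R :> R.
  rewrite -(@pmulr_rgt0 _ (D ^+ i)) ?exprn_gt0 //; apply: lt_le_trans (cardC i).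
  by rewrite !mulr_gt0 ?exprn_gt0 ?ltr0n.
(* The sum is at most [2 * #|U2| + #|U1|]. *)
have sum_d : (\sum_(u in U1) d u <= 2 * n)%N.
  apply: (@leq_trans (\sum_(u in U1) (degree H u + 1))%N).
    by apply: leq_sum => u _; rewrite /d; lia.
  have := sum_degree_part bip deg2; rewrite big_split /= sum1_card.
  have [cov disj _] := bip.
  have : (#|U1| + #|U2| = n)%N.
    by rewrite -cV -cardsT -cov cardsU (disjoint_setI0 disj) cards0 subn0.
  lia.
pose linked u v := [exists z, adj H z u && adj H z v].
suff /(_ U1 (subxx _)) [f [f_inj _ f_good]] : forall S : {set V}, S \subset U1 ->
    exists f : V -> W, [/\ {in S &, injective f},
      forall v, v \in S -> f v \in C (j v) &
      forall u v, u \in S -> v \in S -> u != v -> linked u v ->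
        ~~ bad_pair m G (f u) (f v)].
  exists f; split=> // u v z uU vU uv zu zv; apply: f_good => //.
  by apply/existsP; exists z; rewrite zu.
move=> S; have [k] := ubnP #|S|; elim: k S => // k IH S cS sS.
have [S0|[v0 v0S]] := set_0Vmem S.
  have /card_gt0P[w0 _] : (0 < #|C 0|)%N by have := C_gt0 0; rewrite ltr0n.
  by exists (fun=> w0); split=> [u|v|u]; rewrite S0 inE.
(* A vertex of least degree is embedded last: the others in [S] have level at least [j v], so their
   images already lie in [C (j v)]. *)
pose v := [arg min_(u < v0 | u \in S) d u].
have [vS v_min] : v \in S /\ forall u, u \in S -> (d v <= d u)%N.
  by rewrite /v; case: arg_minnP.
have vU1 := subsetP sS v vS.
have [||f [f_inj f_C f_good]] := IH (S :\ v).
- by move: cS; rewrite (cardsD1 v) vS.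
- by apply: subset_trans sS; apply: subsetDl.
pose L := \bigcup_(z in nbhd H v) (nbhd H z :\ v).
pose F := (f @: (S :\ v)) :|:
  \bigcup_(u in L :&: S) [set y in C (j v) | bad_pair m G (f u) y].
have v_nbr z : adj H v z -> degree H z = 2%N.
  move=> vz; apply: deg2; have [_ disj bp] := bip.
  case: (bp _ _ vz) => [[]//|[vU2 _]].
  by have := disjointFr disj vU1; rewrite vU2.
have cL : (#|L| <= d v)%N.
  apply: leq_trans (card_nbhd_nbhd (d := 1) v_nbr) _.
  by rewrite muln1 leq_maxl.
have LS u : u \in L :&: S -> u \in S :\ v.
  rewrite !inE => /andP[/bigcupP[z _]]; rewrite !inE => /andP[-> _] ->.
  by [].
(* The vertices of [S] have weight at least [d v] each and at most [2 * n] in total, so at most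
   [2 * n / D ^+ (j v).-1] values are taken. [4 <= D] and [cardC] turn this into a quarter of
   [C (j v)]. *)
have used : #|f @: (S :\ v)|%:R <= #|C (j v)|%:R / 4 :> R.
  have h : (#|f @: (S :\ v)| * d v <= 2 * n)%N.
    apply: leq_trans sum_d; apply: leq_trans (_ : (#|S| * d v <= _)%N).
      by rewrite leq_mul2r (leq_trans (leq_imset_card _ _)) ?orbT //
        subset_leq_card // subsetDl.
    rewrite -sum_nat_const [leqRHS](big_setID S) /= (setIidPr sS).
    by apply: leq_trans (leq_addr _ _); apply: leq_sum => u /v_min.
  set c := #|f @: _| in h *.
  have p0 : 0 < D ^+ (j v).-1 by rewrite exprn_gt0.
  rewrite -(ler_pM2l (mulr_gt0 D0 p0)).
  have h1 : D ^+ (j v).-1 * c%:R <= 2 * n%:R.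
    apply: (@le_trans _ _ ((c * d v)%:R)); last by rewrite -natrM ler_nat.
    by rewrite natrM mulrC ler_wpM2l.
  have := cardC (j v).
  have -> : D ^+ j v = D * D ^+ (j v).-1 by rewrite -exprS prednK ?j_gt0.
  have h2 : D * (D ^+ (j v).-1 * c%:R) <= D * (2 * n%:R) by rewrite ler_pM2l.
  have h3 : D * (D * n%:R) >= 4 * (D * n%:R).
    by rewrite ler_wpM2r // mulr_ge0 // ltW.
  move: h2 h3; set X := #|C _|%:R; set Y := D ^+ _; set Z := c%:R.
  by move=> h2 h3 h4; lra.
(* Fewer than [D ^+ j v] vertices [u] share a neighbour with [v], and each blocks a proportion at
   most [2 / 3 / D ^+ j v] of [C (j v)]. *)
have blocked : #|\bigcup_(u in L :&: S) [set y in C (j v) | bad_pair m G (f u) y]|%:R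
    <= 2 / 3 * #|C (j v)|%:R :> R.
  apply: (@le_trans _ _
    (\sum_(u in L :&: S) bad_degree m G (C (j v)) (f u))%:R).
    by rewrite ler_nat; apply: card_bigcup_le_sum.
  have e u : u \in L :&: S ->
      D ^+ j v * (bad_degree m G (C (j v)) (f u))%:R <= 2 / 3 * #|C (j v)|%:R.
    move=> uL; have uS := LS u uL.
    apply: (le_trans (badC _ _ _)).
      apply: (subsetP (decreasing_subset hC (j_mono _ _ _))) (f_C u uS).
      by apply: v_min; move: uS; rewrite inE => /andP[].
    rewrite ler_wpM2r ?ler0n // -[leRHS]expr1.
    by apply: ler_wiXn2l; rewrite ?j_gt0 //; lra.
  rewrite -(@ler_pM2l _ (D ^+ j v)) ?exprn_gt0 // natr_sum mulr_sumr.
  apply: (le_trans (ler_sum _ e)); rewrite sumr_const -[leLHS]mulr_natl.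
  rewrite ler_wpM2r ?mulr_ge0 ?ler0n //; first by lra.
  apply: le_trans (ltW (jP v)); rewrite ler_nat (leq_trans _ cL) //.
  by rewrite subset_leq_card // subsetIl.
(* A free value remains because [1 / 4 + 2 / 3 < 1]. *)
have [w wC wF] : exists2 w, w \in C (j v) & w \notin F.
  apply/subsetPn/negP => /subset_leq_card; apply/negP; rewrite -ltnNge -(ltr_nat R).
  apply: (@le_lt_trans _ _ (#|f @: (S :\ v)|%:R + 2 / 3 * #|C (j v)|%:R)).
    apply: le_trans (lerD (lexx _) blocked); rewrite -natrD ler_nat.
    by rewrite cardsU leq_subr.
  by have := C_gt0 (j v); lra.
move: wF; rewrite inE negb_or => /andP[w_new w_good].
pose g u := if u == v then w else f u.
have gv : g v = w by rewrite /g eqxx.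
have gE u : u != v -> g u = f u by rewrite /g => /negbTE->.
have fw u : u \in S -> u != v -> f u != w.
  move=> uS uv; apply: contraNneq w_new => <-; apply: imset_f.
  by rewrite !inE uv.
have w_ok u : u \in S -> u != v -> linked u v -> ~~ bad_pair m G (f u) w.
  move=> uS uv /existsP[z /andP[zu zv]]; apply: contra w_good => bw.
  apply/bigcupP; exists u; last by rewrite inE wC.
  rewrite inE uS andbT; apply/bigcupP; exists z.
    by rewrite inE adj_sym.
  by rewrite !inE uv.
exists g; split.
- move=> x y xS yS; have [->|xv] := eqVneq x v; have [->|yv] := eqVneq y v => //.
  + by rewrite gv gE // => e; have := fw y yS yv; rewrite -e eqxx.
  + by rewrite gv gE // => e; have := fw x xS xv; rewrite e eqxx.
  + by rewrite !gE //; apply: f_inj; rewrite !inE ?xv ?yv.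
- move=> x xS; have [->|xv] := eqVneq x v; first by rewrite gv.
  by rewrite gE //; apply: f_C; rewrite !inE xv.
- move=> x y xS yS; have [->|xv] := eqVneq x v.
    rewrite eq_sym => yv; rewrite gv gE // bad_pairC => vy; apply: w_ok => //.
    by case/existsP: vy => z; rewrite andbC => vy; apply/existsP; exists z.
  have [->|yv] := eqVneq y v.
    by move=> _; rewrite gv gE //; apply: w_ok.
  by rewrite !gE //; apply: f_good; rewrite !inE ?xv ?yv.
Qed.

(** * Greedy embedding of [U2] *)

(** The two neighbours of a vertex of [U2] have images with at least [n] common neighbours, and
    fewer than [n] vertices of [G] are occupied when it is placed. *)
Lemma embed_degree_two_part (n : nat) (V : finType) (H : sgraph V) (U1 U2 : {set V})
    (W : finType) (G : sgraph W) (f : V -> W) :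
  bipartition H U1 U2 -> #|V| = n ->
  (forall u, u \in U2 -> degree H u = 2%N) ->
  {in U1 &, injective f} ->
  (forall u v z, u \in U1 -> v \in U1 -> u != v -> adj H z u -> adj H z v ->
      ~~ bad_pair n G (f u) (f v)) ->
  is_subgraph H G.
Proof.
move=> [cov disj bip] cV deg2 f_inj f_good.
have notU2 u : u \in U1 -> u \notin U2 by move=> h; rewrite (disjointFr disj h).
suff /(_ [set: V]) [g [g_inj g_f g_adj]] : forall S : {set V},
    exists g : V -> W, [/\ {in U1 :|: S &, injective g}, {in U1, g =1 f} &
      forall x y, x \in U1 -> y \in U2 -> y \in S -> adj H x y ->
        adj G (g x) (g y)].
  exists g; split=> [x y|x y xy]; first by apply: g_inj; rewrite setUT inE.
  by case: (bip _ _ xy) => -[hx hy]; [|rewrite adj_sym];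
    apply: g_adj => //; rewrite ?inE // adj_sym.
move=> S; have [k] := ubnP #|S|; elim: k S => // k IH S cS.
have [S0|[v vS]] := set_0Vmem (S :&: U2).
  exists f; split=> // [x y|x y _ yU2 yS].
    suff e : U1 :|: S \subset U1 by move=> /(subsetP e) hx /(subsetP e) hy; apply: f_inj.
    apply/subsetP => u; have := in_setT u; rewrite -cov !inE.
    have := in_set0 u; rewrite -S0 !inE.
    by case: (u \in U1) => //=; case: (u \in S); case: (u \in U2).
  by have := in_set0 y; rewrite -S0 inE yS yU2.
move: vS; rewrite inE => /andP[vS vU2].
have [|g [g_inj g_f g_adj]] := IH (S :\ v).
  by move: cS; rewrite (cardsD1 v) vS.
have vU1 : v \notin U1 by apply: contraL vU2; apply: notU2.
have /cards2P[a [b [ab vE]]] : #|nbhd H v| == 2%N by rewrite -(deg2 v vU2).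
have nb u : adj H v u = (u == a) || (u == b).
  by rewrite -in_set2 -vE inE.
have va : adj H v a by rewrite nb eqxx.
have vb : adj H v b by rewrite nb eqxx orbT.
have nbU1 u : adj H v u -> u \in U1.
  by case/bip => -[] // /notU2; rewrite vU2.
have := f_good a b v (nbU1 _ va) (nbU1 _ vb) ab va vb.
rewrite /bad_pair -leqNgt => hcard.
pose T := U1 :|: (S :\ v).
(* Strict because [v] itself is not in [T]. *)
have cT : (#|g @: T| < n)%N.
  apply: (leq_ltn_trans (leq_imset_card _ _)); rewrite -cV -cardsT.
  apply: proper_card; rewrite properE subsetT; apply/subsetPn; exists v => //.
  by rewrite !inE eqxx orbF.
have [w wN wT] : exists2 w, w \in nbhd G (f a) :&: nbhd G (f b) & w \notin g @: T.
  apply/subsetPn/negP => /subset_leq_card h.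
  by have := leq_trans hcard h; rewrite leqNgt cT.
pose h u := if u == v then w else g u.
have hv : h v = w by rewrite /h eqxx.
have hE u : u != v -> h u = g u by rewrite /h => /negbTE->.
have gw u : u \in U1 :|: S -> u != v -> u \in T /\ g u != w.
  move=> uS uv; have uT : u \in T by move: uS; rewrite !inE uv.
  by split=> //; apply: contraNneq wT => <-; apply: imset_f.
have U1v u : u \in U1 -> u != v by move=> uU; apply: contraNneq vU1 => <-.
exists h; split.
- move=> x y xS yS; have [->|xv] := eqVneq x v; have [->|yv] := eqVneq y v => //.
  + by rewrite hv hE // => e; have [_] := gw y yS yv; rewrite -e eqxx.
  + by rewrite hv hE // => e; have [_] := gw x xS xv; rewrite e eqxx.
  + have [xT _] := gw x xS xv; have [yT _] := gw y yS yv.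
    by rewrite !hE //; apply: g_inj.
- by move=> x xU; rewrite hE ?U1v // g_f.
- move=> x y xU yU yS; rewrite hE ?U1v //; have [->|yv] := eqVneq y v.
    rewrite hv g_f // adj_sym nb; move: wN; rewrite !inE => /andP[wa wb].
    by case/orP => /eqP->.
  by rewrite hE //; apply: g_adj => //; rewrite !inE yv.
Qed.

(** * Edges of [G] and the conclusion *)

(** When ordered adjacent pairs are sent to their edges, each fibre contains both orders, which
    differ by irreflexivity. *)
Lemma double_card_edges (V : finType) (G : sgraph V) :
  (2 * #|edges G| <= \sum_x degree G x)%N.
Proof.
pose P := [set p : V * V | adj G p.1 p.2].
have -> : (\sum_x degree G x = #|P|)%N.
  rewrite -sum1_card (eq_bigl (fun p => xpredT p.1 && adj G p.1 p.2)).
    rewrite -(pair_big_dep xpredT (fun x y => adj G x y) (fun _ _ => 1%N)) /=.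
    by apply: eq_bigr => x _; rewrite sum1_card /degree cardsE.
  by move=> p; rewrite inE.
pose e (p : V * V) := [set p.1; p.2].
rewrite -[leqRHS]sum1_card (partition_big e [in edges G]) /= => [|p]; last first.
  by rewrite inE => hp; apply/imset2P; exists p.1 p.2; rewrite ?inE.
rewrite mulnC -sum_nat_const; apply: leq_sum => E /imset2P[x y _].
rewrite inE => /andP[_ xy] ->.
have xney : x != y by apply: contraTneq xy => ->; rewrite adj_irr.
rewrite sum1_card.
apply: leq_trans (_ : (#|[set (x, y); (y, x)]| <= _)%N).
  by rewrite cards2 xpair_eqE negb_and xney.
apply/subset_leq_card/subsetP => p; rewrite !inE => /orP[]/eqP->.
  by rewrite unfold_in /= inE /= xy eqxx.
by rewrite unfold_in /= inE /= adj_sym xy /e /= setUC eqxx.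
Qed.

(** The degree sum is at least [4 * eps * N ^+ 2]. Vertices below the threshold contribute at most
    half of that, and every other vertex at most [2 * N]. *)
Lemma card_high_degree (R : realType) (eps : R) (N : nat) (W : finType)
    (G : sgraph W) :
  (0 < N)%N -> #|W| = (2 * N)%N -> #|edges G|%:R = 2 * eps * N%:R ^+ 2 ->
  0 <= eps ->
  eps * N%:R <= #|[set x | eps * N%:R <= (degree G x)%:R]|%:R.
Proof.
move=> N0 cW cE e0; set A := [set x | _].
have N0R : 0 < N%:R :> R by rewrite ltr0n.
have h : (\sum_x degree G x)%:R <= #|A|%:R * (2 * N%:R) + 2 * N%:R * (eps * N%:R).
  rewrite natr_sum (bigID [in A]) /= lerD //.
    rewrite -sum1_card natr_sum mulr_suml; apply: ler_sum => x _.
    by rewrite mul1r -natrM -cW ler_nat max_card.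
  apply: (@le_trans _ _ (\sum_(x | x \notin A) eps * N%:R)).
    by apply: ler_sum => x; rewrite inE -ltNge => /ltW.
  rewrite sumr_const -[leLHS]mulr_natl ler_wpM2r ?mulr_ge0 ?ler0n //.
  by rewrite -natrM -cW ler_nat max_card.
have : (2 * #|edges G|)%:R <= (\sum_x degree G x)%:R :> R.
  by rewrite ler_nat double_card_edges.
rewrite natrM cE => h'.
rewrite -(ler_pM2r N0R); lra.
Qed.

Theorem theorem5p1 (R : realType) (eps : R) (n N : nat)
    (V : finType) (H : sgraph V) (U1 U2 : {set V})
    (W : finType) (G : sgraph W) :
  0 < eps ->
  bipartition H U1 U2 ->
  #|V| = n ->
  (forall u : V, u \in U2 -> degree H u = 2%N) ->
  #|W| = (2 * N)%N ->
  (#|edges G|)%:R = 2 * eps * N%:R ^+ 2 ->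
  N%:R >= 128 * eps ^- 3 * n%:R ->
  is_subgraph H G.
Proof.
move=> e0 bip cV deg2 cW cE hN.
(* For [n = 0] the set [W] may be empty too, so the map is built from the emptiness of [V]. *)
have [n0|n0] := posnP n.
  have V0 : V -> False.
    by move=> x; have /card0_eq/(_ x) := etrans cV n0; rewrite inE.
  exists (fun x => False_rect W (V0 x)).
  by split=> x; case: (V0 x).
have n0R : 0 < n%:R :> R by rewrite ltr0n.
have N0 : (0 < N)%N.
  rewrite -(ltr0n R); apply: lt_le_trans hN.
  by rewrite !mulr_gt0 // invr_gt0 exprn_gt0.
have N0R : 0 < N%:R :> R by rewrite ltr0n.
have hm : 128 * n%:R <= eps ^+ 3 * N%:R.
  have e3 : 0 < eps ^+ 3 by rewrite exprn_gt0.
  rewrite -(ler_pM2l e3) in hN; apply: le_trans hN.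
  by rewrite le_eqVlt; apply/orP; left; apply/eqP; field; rewrite gt_eqF.
pose S := [set x | eps * N%:R <= (degree G x)%:R].
have cS : eps * N%:R <= #|S|%:R := card_high_degree N0 cW cE (ltW e0).
(* [S] has at most [2 * N] elements; the resulting bound is what [4 <= D] requires. *)
have e2 : eps <= 2.
  rewrite -(ler_pM2r N0R); apply: (le_trans cS).
  by rewrite -natrM -cW ler_nat max_card.
have hdeg x : x \in S -> eps * N%:R <= (degree G x)%:R by rewrite inE.
have [C [C_dec C_card C_bad]] := bad_degree_chain e0 N0 cW hm hdeg.
pose D := 8 / eps.
have D0 : 0 < D by rewrite divr_gt0.
have De : D * eps = 8 by rewrite /D divfK ?gt_eqF.
have D4 : 4 <= D by rewrite /D ler_pdivlMr //; lra.
have [||f [f_inj f_good]] :=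
    @embed_high_degree_part R D n n V H U1 U2 W G C D4 n0 cV bip deg2 C_dec.
(* Powers of [D] cancel the losses [eps / 8]. What remains is [2 * D ^+ 2 * n = 128 * n / eps ^+ 2
   <= eps * N], the hypothesis on [N] again. *)
- move=> i; apply: (@le_trans _ _ (D ^+ i * ((eps / 8) ^+ i * #|S|%:R))).
    have -> : D ^+ i * ((eps / 8) ^+ i * #|S|%:R) = #|S|%:R.
      rewrite mulrA -exprMn (_ : D * (eps / 8) = 1) ?expr1n ?mul1r //.
      by rewrite mulrA De divff ?pnatr_eq0.
    apply: le_trans cS.
    have -> : 2 * D ^+ 2 * n%:R = (128 * n%:R) / eps ^+ 2.
      by rewrite /D; field; rewrite gt_eqF.
    rewrite ler_pdivrMr ?exprn_gt0 //; apply: (le_trans hm).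
    by rewrite exprS; lra.
  by rewrite ler_pM2l ?exprn_gt0.
- move=> i x xC.
  have -> : (2 / 3) ^+ i = D ^+ i * (eps / 12) ^+ i :> R.
    by rewrite -exprMn; congr (_ ^+ _); rewrite mulrA De; field.
  by rewrite -mulrA ler_pM2l ?exprn_gt0 // C_bad.
exact: embed_degree_two_part bip cV deg2 f_inj f_good.
Qed.
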